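(* Let $n\ge1$ be an integer, let $\Phi$ be an Orlicz function and let $\lambda\in\mathbb{R}$. The central Morrey--Orlicz space $M^{\Phi,\lambda}(0)$ on $\mathbb{R}^n$ satisfies $M^{\Phi,\lambda}(0)\ne\{0\}$ if and only if $\lambda\ge0$.
   Context: An Orlicz function is a strictly increasing, continuous, convex function $\Phi\colon[0,\infty)\to[0,\infty)$ with $\Phi(0)=0$. For $r>0$ let $B_r=\{x\in\mathbb{R}^n:|x|<r\}$, and let $|E|$ denote the Lebesgue measure of $E$. For $\lambda\in\mathbb{R}$, the central Morrey--Orlicz space $M^{\Phi,\lambda}(0)$ consists of all $f\in L^1_{loc}(\mathbb{R}^n)$ (functions equal almost everywhere being identified) with $$\|f\|_{M^{\Phi,\lambda}(0)}=\sup_{r>0}\|f\|_{\Phi,\lambda,B_r}<\infty,\qquad \|f\|_{\Phi,\lambda,B_r}=\inf\Big\{\varepsilon>0:\frac{1}{|B_r|^{\lambda}}\int_{B_r}\Phi\Big(\frac{|f(x)|}{\varepsilon}\Big)dx\le1\Big\}.$$ *)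

(* Defs.v *)
From HB Require Import structures.
From mathcomp Require Import all_boot all_order all_algebra.
From mathcomp Require Import all_classical all_reals all_analysis.

Set Implicit Arguments.
Unset Strict Implicit.
Unset Printing Implicit Defensive.

Import Order.TTheory GRing.Theory Num.Theory.
Import numFieldNormedType.Exports.

Local Open Scope classical_set_scope.
Local Open Scope ring_scope.

(* R^n is rendered as 'rV[R]_n, with the product sigma-algebra, which is the
   Borel one. Completing it would not change the space of classes of functions
   modulo equality almost everywhere: every Lebesgue measurable function agrees
   almost everywhere with a Borel one. *)

Definition measure_rV_display : measure_display -> measure_display.
Proof. exact. Qed.

Section measurable_rV.
Context {d : measure_display} {T : measurableType d} (n : nat).

Let coors : 'I_n -> 'rV[T]_n -> T := fun i x => x ord0 i.

Let rV_set0 : g_sigma_preimage coors set0.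
Proof. exact: sigma_algebra0. Qed.

Let rV_setC A : g_sigma_preimage coors A -> g_sigma_preimage coors (~` A).
Proof. exact: sigma_algebraC. Qed.

Let rV_bigcup (F : _^nat) : (forall i, g_sigma_preimage coors (F i)) ->
  g_sigma_preimage coors (\bigcup_i (F i)).
Proof. exact: sigma_algebra_bigcup. Qed.

HB.instance Definition _ := @isMeasurable.Build (measure_rV_display d)
  'rV[T]_n (g_sigma_preimage coors) rV_set0 rV_setC rV_bigcup.

End measurable_rV.

Lemma measurable_coord_rV {d : measure_display} {T : measurableType d} n
    (i : 'I_n) : measurable_fun [set: 'rV[T]_n] (fun x => x ord0 i).
Proof.
move=> _ Y mY; rewrite setTI; apply: sub_sigma_algebra => /=.
rewrite -bigcup_seq/=; exists i => /=; first by rewrite mem_index_enum.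
by exists Y => //; rewrite setTI.
Qed.

Lemma measurable_fun_rVP {d1 d2 : measure_display} {S : measurableType d1}
    {T : measurableType d2} n (f : S -> 'rV[T]_n) :
  measurable_fun setT f <->
  forall i, measurable_fun setT (fun s => f s ord0 i).
Proof.
split=> [mf i|mf _ A mA].
  exact: (measurableT_comp (measurable_coord_rV i) mf).
rewrite setTI.
suff /(_ A mA) : measurable `<=` [set B | measurable (f @^-1` B)] by [].
apply: smallest_sub => /=.
  split=> [|B mB|F mF] /=; first by rewrite preimage_set0.
    by rewrite setTD preimage_setC; exact: measurableC.
  by rewrite preimage_bigcup; apply: bigcup_measurable => k _; exact: mF.
rewrite -bigcup_seq => B [i _ [C mC <-]] /=; rewrite setTI.
by rewrite -[X in measurable X]setTI; exact: mf.
Qed.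

Section lebesgue_rV.
Context {R : realType}.
Local Open Scope ereal_scope.

Definition cons_rV n (p : measurableTypeR R * 'rV[R]_n) : 'rV[R]_n.+1 :=
  row_mx (const_mx p.1 : 'rV_1) p.2.

Lemma cons_rV0 n p : @cons_rV n p ord0 ord0 = p.1.
Proof.
rewrite /cons_rV mxE; case: splitP => [j _|k /= /eqP]; last by rewrite add1n.
by rewrite mxE.
Qed.

Lemma cons_rVS n p i : @cons_rV n p ord0 (lift ord0 i) = p.2 ord0 i.
Proof.
rewrite /cons_rV mxE; case: splitP => [j|k].
  by rewrite ord1.
by rewrite lift0 add1n => -[/val_inj ->].
Qed.

Lemma measurable_cons_rV n : measurable_fun setT (@cons_rV n).
Proof.
apply/measurable_fun_rVP => i; have [j ->|->] := unliftP ord0 i.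
  under eq_fun do rewrite cons_rVS.
  exact: (measurableT_comp (measurable_coord_rV j) measurable_snd).
by under eq_fun do rewrite cons_rV0; exact: measurable_fst.
Qed.

Fixpoint lebesgue_rV n : set 'rV[R]_n -> \bar R :=
  match n with
  | 0 => \d_(0%R : 'rV[R]_0)
  | n'.+1 => pushforward (lebesgue_measure \x @lebesgue_rV n') (@cons_rV n')
  end.

Lemma lebesgue_rV_sigma_finite_measure n :
  exists mu : {sigma_finite_measure set 'rV[R]_n -> \bar R},
    @lebesgue_rV n = mu.
Proof.
elim: n => [|n [mu muE]]; first by exists (\d_(0%R : 'rV[R]_0)).
pose m : {measure set 'rV[R]_n.+1 -> \bar R} :=
  measure_function_pushforward__canonical__measure_function_Measure
    (lebesgue_measure \x mu) (@measurable_cons_rV n).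
pose uncons (x : 'rV[R]_n.+1) : measurableTypeR R * 'rV[R]_n :=
  (x ord0 ord0, \row_i x ord0 (lift ord0 i)).
have consK : cancel (@cons_rV n) uncons.
  move=> [a x]; rewrite /uncons cons_rV0; congr pair.
  by apply/rowP => i; rewrite mxE cons_rVS.
have muncons : measurable_fun setT uncons.
  apply: measurable_fun_pair; first exact: measurable_coord_rV.
  apply/measurable_fun_rVP => i; under eq_fun do rewrite mxE.
  exact: measurable_coord_rV.
have msig : sigma_finite setT m.
  have [F TF Foo] : sigma_finite setT (lebesgue_measure \x mu).
    exact: isSigmaFinite.sigma_finiteT
      (lebesgue_integral_fubini.measure_function_Measure_isSigmaFinite__to__measure_function_isSigmaFinite
         lebesgue_measure mu).
  exists (fun k => uncons @^-1` F k).
    by rewrite -preimage_bigcup -TF preimage_setT.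
  move=> k; have [mF mFoo] := Foo k; split.
    by rewrite -[X in measurable X]setTI; exact: muncons.
  rewrite /m/= /pushforward -comp_preimage.
  by rewrite (_ : uncons \o _ = idfun)//; apply/funext => p /=; rewrite consK.
pose sm : {sigma_finite_measure set 'rV[R]_n.+1 -> \bar R} :=
  HB.pack (Measure.sort m) (Measure_isSigmaFinite.Build _ _ _ m msig).
by exists sm; rewrite /= muE.
Qed.

Section lebesgue_rV_measure.
Variable n : nat.

Let mu := projT1 (cid (lebesgue_rV_sigma_finite_measure n)).

Let muE : @lebesgue_rV n = mu.
Proof. exact: projT2 (cid (lebesgue_rV_sigma_finite_measure n)). Qed.

Let mu0 : @lebesgue_rV n set0 = 0.
Proof. by rewrite muE measure0. Qed.

Let mu_ge0 A : 0 <= @lebesgue_rV n A.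
Proof. by rewrite muE. Qed.

Let mu_sigma_additive : semi_sigma_additive (@lebesgue_rV n).
Proof. by rewrite muE; exact: measure_semi_sigma_additive. Qed.

HB.instance Definition _ :=
  isMeasure.Build _ _ _ (@lebesgue_rV n) mu0 mu_ge0 mu_sigma_additive.

Let mu_sigma_finite : sigma_finite setT (@lebesgue_rV n).
Proof. by rewrite muE; exact: sigma_finiteT. Qed.

HB.instance Definition _ :=
  Measure_isSigmaFinite.Build _ _ _ (@lebesgue_rV n) mu_sigma_finite.

End lebesgue_rV_measure.

Lemma lebesgue_rV_box n (A : 'I_n -> set R) :
  (forall i, measurable (A i)) ->
  lebesgue_rV [set x : 'rV[R]_n | forall i, A i (x ord0 i)]
  = \prod_(i < n) lebesgue_measure (A i).
Proof.
elim: n A => [A _|n IHn A mA].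
  by rewrite big_ord0 /= diracE mem_set// => -[].
have mB : measurable
    [set x : 'rV[R]_n | forall i, A (lift ord0 i) (x ord0 i)].
  rewrite [X in measurable X](_ : _ = \bigcap_(i in [set: 'I_n])
      ((fun x : 'rV[R]_n => x ord0 i) @^-1` A (lift ord0 i))).
    apply: fin_bigcap_measurable => // i _.
    by rewrite -[X in measurable X]setTI; exact: measurable_coord_rV.
  by apply/seteqP; split=> x /= Ax i; [move=> _; exact: Ax|exact: Ax].
rewrite big_ord_recl -IHn// -product_measure1E//; last exact: mA.
rewrite /= /pushforward; congr (_ _); apply/seteqP; split=> p /=.
  move=> Ap; split=> [|i]; first by have := Ap ord0; rewrite cons_rV0.
  by have := Ap (lift ord0 i); rewrite cons_rVS.
move=> [Ap0 ApS] i; have [j ->|->] := unliftP ord0 i.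
  by rewrite cons_rVS; exact: ApS.
by rewrite cons_rV0.
Qed.
End lebesgue_rV.

Section central_Morrey_Orlicz.
Context {R : realType}.

Definition orlicz_function (Phi : R -> R) : Prop :=
  [/\ Phi 0 = 0,
      {in `[0, +oo[, forall x, 0 <= Phi x},
      {in `[0, +oo[ &, {homo Phi : x y / x < y}},
      {within `[0, +oo[, continuous Phi} &
      convex_function (E := R^o) `[0, +oo[%classic Phi].

(* The library norm of 'rV[R]_n is the sup norm, hence this definition. *)
Definition euclidean_norm n (x : 'rV[R]_n) : R :=
  Num.sqrt (\sum_(i < n) x ord0 i ^+ 2).

Definition central_ball n (r : R) : set 'rV[R]_n :=
  [set x | euclidean_norm x < r].

Definition locally_integrable_rV n (f : 'rV[R]_n -> R) : Prop :=
  measurable_fun setT f /\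
  forall K : set 'rV[R]_n, compact K ->
    (\int[@lebesgue_rV R n]_(x in K) `|f x|%:E < +oo)%E.

Definition Morrey_Orlicz_ball_norm n (Phi : R -> R) (lambda r : R)
    (f : 'rV[R]_n -> R) : \bar R :=
  let B : set 'rV[R]_n := central_ball r in
  ereal_inf [set e%:E | e in [set e : R | 0 < e /\
    ((fine (lebesgue_rV B) `^ lambda)^-1%:E *
      \int[@lebesgue_rV R n]_(x in B) (Phi (`|f x| / e))%:E <= 1)%E]].

Definition central_Morrey_Orlicz_norm n (Phi : R -> R) (lambda : R)
    (f : 'rV[R]_n -> R) : \bar R :=
  ereal_sup [set Morrey_Orlicz_ball_norm Phi lambda r f
            | r in [set r : R | 0 < r]].

(* Classes modulo equality almost everywhere; an element f of this quotient
   coerces to a representative of its class. Local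
   integrability and the norm do not depend on the representative. *)
Local Notation ae_function n :=
  {mfun_ (@lebesgue_rV R n), 'rV[R]_n >-> R}.

Definition ae_zero n : ae_function n :=
  (\pi_(ae_function n) (cst 0 : {mfun 'rV[R]_n >-> R}))%qT.

Definition central_Morrey_Orlicz n (Phi : R -> R) (lambda : R) :
    set (ae_function n) :=
  [set f : ae_function n |
    locally_integrable_rV f /\
    (central_Morrey_Orlicz_norm Phi lambda f < +oo)%E].

End central_Morrey_Orlicz.

Arguments ae_zero {R} n.
Arguments central_Morrey_Orlicz {R} n Phi lambda.

(* Main.v *)
(** If [lambda < 0] and [f] has norm less than [C], then the integral of
    [Phi (|f| / C)] over [B_r] is at most [|B_r|^lambda]. The left-hand side is
    nondecreasing in [r] and the right-hand side tends to [0] as [r] tends to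
    infinity, so [f] vanishes almost everywhere. If [0 <= lambda], the space
    contains the indicator function of the cube [[1, 2]^n]: this cube does not
    meet [B_r] for [r <= 1], which takes care of the small balls, and
    [|B_r|^lambda >= |B_1|^lambda > 0] for [r >= 1]. *)

Require Import Defs.
From mathcomp Require Import all_boot all_order all_algebra.
From mathcomp Require Import all_classical all_reals all_analysis.
From mathcomp Require Import measurable_realfun.

Import Order.TTheory GRing.Theory Num.Theory.
Local Open Scope classical_set_scope.
Local Open Scope ring_scope.

(** * Volume of Euclidean balls, by comparison with cubes *)

Section euclidean_balls.
Context {R : realType}.
Implicit Types (n : nat) (r : R).

Lemma euclidean_norm_ltE n r (x : 'rV[R]_n) : 0 < r ->
  (euclidean_norm x < r) = (\sum_(i < n) x ord0 i ^+ 2 < r ^+ 2).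
Proof.
move=> r0; rewrite -[LHS](@ltr_pXn2r _ 2)// ?nnegrE ?sqrtr_ge0 ?ltW//.
by rewrite sqr_sqrtr// sumr_ge0// => i _; exact: sqr_ge0.
Qed.

Lemma coord_le_euclidean_norm n (x : 'rV[R]_n) i :
  `|x ord0 i| <= euclidean_norm x.
Proof.
rewrite -sqrtr_sqr ler_wsqrtr// (bigD1 i)//= lerDl.
by rewrite sumr_ge0// => j _; exact: sqr_ge0.
Qed.

Lemma measurable_central_ball n r :
  0 < r -> measurable (central_ball r : set 'rV[R]_n).
Proof.
move=> r0; rewrite /central_ball.
under eq_set do rewrite euclidean_norm_ltE//.
have mS : measurable_fun [set: 'rV[R]_n]
    (fun x : 'rV[R]_n => \sum_(i < n) x ord0 i ^+ 2).
  apply: measurable_sum => i; apply: measurable_funX.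
  exact: measurable_coord_rV.
rewrite -[X in measurable X]setTI.
have := mS measurableT `]-oo, r ^+ 2[%classic (measurable_itv _).
congr (measurable (_ `&` _)); apply/seteqP; split => x /=; by rewrite in_itv/=.
Qed.

Lemma measurable_box_rV n (A : 'I_n -> set R) :
  (forall i, measurable (A i)) ->
  measurable [set x : 'rV[R]_n | forall i, A i (x ord0 i)].
Proof.
move=> mA; rewrite [X in measurable X](_ : _ = \bigcap_(i in [set: 'I_n])
    ((fun x : 'rV[R]_n => x ord0 i) @^-1` A i)).
  apply: fin_bigcap_measurable => // i _.
  by rewrite -[X in measurable X]setTI; exact: measurable_coord_rV.
by apply/seteqP; split=> x /= Ax i; [move=> _; exact: Ax|exact: Ax].
Qed.

Definition cube_rV n (a b : R) : set 'rV[R]_n :=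
  [set x | forall i, x ord0 i \in `[a, b]].

Lemma measurable_cube_rV n a b : measurable (cube_rV n a b).
Proof.
by apply: (@measurable_box_rV _ (fun=> `[a, b]%classic)) => i;
  exact: measurable_itv.
Qed.

Lemma lebesgue_rV_cube n a b : a < b ->
  lebesgue_rV (cube_rV n a b) = ((b - a) ^+ n)%:E.
Proof.
move=> ab.
rewrite (lebesgue_rV_box (A := fun=> `[a, b]%classic)); last first.
  by move=> i; exact: measurable_itv.
under eq_bigr do rewrite lebesgue_measure_itv/= lte_fin ab -EFinB.
by rewrite prodEFin prodr_const card_ord.
Qed.

Lemma central_ball_sub_cube n r :
  (central_ball r : set 'rV[R]_n) `<=` cube_rV n (- r) r.
Proof.
move=> x; rewrite /central_ball/= => xr i; rewrite in_itv/= -ler_norml.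
by rewrite (le_trans (coord_le_euclidean_norm _ _ _))// ltW.
Qed.

(** Each squared coordinate is at most [(r / n.+1%:R) ^+ 2 <= r ^+ 2 / n.+1%:R], and [n] such terms
    add up to strictly less than [r ^+ 2]. Dividing by [n.+1] rather than [n] makes the inequality
    strict and covers [n = 0]. *)
Lemma cube_sub_central_ball n r : 0 < r ->
  cube_rV n (- (r / n.+1%:R)) (r / n.+1%:R) `<=` central_ball r.
Proof.
move=> r0 x xr; rewrite /central_ball/= euclidean_norm_ltE//.
apply: (@le_lt_trans _ _ (\sum_(i < n) (r ^+ 2 / n.+1%:R))).
  apply: ler_sum => i _; have := xr i; rewrite in_itv/= -ler_norml => xir.
  rewrite -real_normK ?num_real//.
  apply: (@le_trans _ _ ((r / n.+1%:R) ^+ 2)).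
    by rewrite ler_pXn2r// nnegrE divr_ge0// ltW.
  rewrite exprMn ler_pM2l ?exprn_gt0// expr2 ler_piMr ?invr_ge0//.
  by rewrite invf_le1// ler1n.
rewrite sumr_const card_ord -(mulr_natr _ n) -mulrA gtr_pMr ?exprn_gt0//.
by rewrite mulrC ltr_pdivrMr// mul1r ltr_nat.
Qed.

Lemma lebesgue_rV_central_ball_fin n r : 0 < r ->
  lebesgue_rV (central_ball r : set 'rV[R]_n) \is a fin_num.
Proof.
move=> r0; rewrite ge0_fin_numE ?measure_ge0//.
apply: (@le_lt_trans _ _ (lebesgue_rV (cube_rV n (- r) r))).
  apply: le_measure; rewrite ?inE.
  - exact: measurable_central_ball.
  - exact: measurable_cube_rV.
  - exact: central_ball_sub_cube.
by rewrite lebesgue_rV_cube ?ltry// gtrN.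
Qed.

(** The lower bound is the volume of the inscribed cube of [cube_sub_central_ball]. *)
Lemma lebesgue_rV_central_ball_ge n r : 0 < r ->
  (r *+ 2 / n.+1%:R) ^+ n <=
  fine (lebesgue_rV (central_ball r : set 'rV[R]_n)).
Proof.
move=> r0; rewrite -lee_fin fineK ?lebesgue_rV_central_ball_fin//.
have rn0 : 0 < r / n.+1%:R by rewrite divr_gt0.
rewrite (_ : r *+ 2 / _ = r / n.+1%:R - - (r / n.+1%:R)); last first.
  by rewrite opprK mulr2n mulrDl.
rewrite -lebesgue_rV_cube ?gtrN//.
apply: le_measure; rewrite ?inE.
- exact: measurable_cube_rV.
- exact: measurable_central_ball.
- exact: cube_sub_central_ball.
Qed.

Lemma lebesgue_rV_central_ball_gt0 n r : 0 < r ->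
  0 < fine (lebesgue_rV (central_ball r : set 'rV[R]_n)).
Proof.
move=> r0; apply: lt_le_trans (lebesgue_rV_central_ball_ge n r r0).
by rewrite exprn_gt0// divr_gt0// mulrn_wgt0.
Qed.

Lemma le_lebesgue_rV_central_ball n r s : 0 < r -> r <= s ->
  fine (lebesgue_rV (central_ball r : set 'rV[R]_n)) <=
  fine (lebesgue_rV (central_ball s : set 'rV[R]_n)).
Proof.
move=> r0 rs; have s0 := lt_le_trans r0 rs.
rewrite fine_le ?lebesgue_rV_central_ball_fin//.
apply: le_measure; rewrite ?inE; try exact: measurable_central_ball.
by move=> x /= /lt_le_trans; exact.
Qed.

Lemma lebesgue_rV_central_ball_unbounded n r0 K : (0 < n)%N ->
  exists2 r, r0 <= r /\ 0 < r &
    K <= fine (lebesgue_rV (central_ball r : set 'rV[R]_n)).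
Proof.
(* [m] dominates [r0], [K] and [1]. The ball of radius [m * n.+1%:R] contains a cube of side
   [m *+ 2], whose volume [(m *+ 2) ^+ n] is at least [m *+ 2] because [1 <= n] and
   [1 <= m *+ 2]. *)
move=> n0; pose m := `|r0| + `|K| + 1.
have m1 : 1 <= m by rewrite lerDr addr_ge0.
have m0 : 0 < m := lt_le_trans ltr01 m1.
have n1 : 1 <= n.+1%:R :> R by rewrite ler1n.
exists (m * n.+1%:R).
  split; last exact: mulr_gt0.
  apply: (@le_trans _ _ m); last by rewrite ler_pMr.
  by rewrite (le_trans (ler_norm _))// /m -addrA lerDl addr_ge0.
apply: (le_trans _ (lebesgue_rV_central_ball_ge _ _ _)); last exact: mulr_gt0.
rewrite mulrnAl mulfK//; apply: (@le_trans _ _ m).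
  by rewrite (le_trans (ler_norm _))// /m -addrA addrCA lerDl addr_ge0.
apply: (@le_trans _ _ (m *+ 2)); first by rewrite mulr2n lerDl ltW.
by rewrite ler_eXnr// mulr2n -[leLHS]addr0 lerD// ltW.
Qed.

Lemma central_ball_pow_lt0_small n r0 (lambda e : R) : (0 < n)%N ->
  lambda < 0 -> 0 < e -> exists2 r, r0 <= r /\ 0 < r &
    fine (lebesgue_rV (central_ball r : set 'rV[R]_n)) `^ lambda <= e.
Proof.
move=> n0 l0 e0.
have [r [r0r rp] Kr] :=
  lebesgue_rV_central_ball_unbounded n r0 (e `^ lambda^-1) n0.
exists r => //.
have B0 := @lebesgue_rV_central_ball_gt0 n r rp.
have -> : lambda = - (- lambda) by rewrite opprK.
rewrite powRN -[leRHS]invrK lef_pV2 ?posrE ?invr_gt0 ?powR_gt0//.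
have -> : e^-1 = (e `^ lambda^-1) `^ (- lambda).
  by rewrite -powRrM mulrN mulVf ?lt_eqF// powR_inv1// ltW.
by rewrite ge0_ler_powR ?nnegrE ?oppr_ge0 ?powR_ge0// ltW.
Qed.
End euclidean_balls.

(* Measurability of [D] is not assumed, so that for [D] compact there is no need
   to relate the topology of ['rV[R]_n] to its sigma-algebra. *)
Lemma ge0_le_integral_setT d (T : measurableType d) (R : realType)
    (mu : {measure set T -> \bar R}) (D : set T) (f : T -> \bar R) :
  (forall x, 0 <= f x)%E -> (\int[mu]_(x in D) f x <= \int[mu]_x f x)%E.
Proof.
move=> f0; rewrite integral_mkcond ge0_integralTE; last first.
  by move=> x; apply: erestrict_ge0 => y _.
rewrite ge0_integralTE//; apply: ereal_sup_le => _ /= [h hf <-].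
exists h => // x; apply: (le_trans (hf x)).
by rewrite /patch; case: ifP.
Qed.

(** * Elementary properties of Orlicz functions *)

Section orlicz.
Context {R : realType} (Phi : R -> R) (Phi_orlicz : orlicz_function Phi).

Lemma orlicz0 : Phi 0 = 0.
Proof. by case: Phi_orlicz. Qed.

Lemma orlicz_ge0 x : 0 <= x -> 0 <= Phi x.
Proof.
by case: Phi_orlicz => _ + _ _ _ x0; apply; rewrite in_itv/= andbT.
Qed.

Lemma orlicz_gt0 x : 0 < x -> 0 < Phi x.
Proof.
case: Phi_orlicz => P0 _ + _ _ x0; rewrite -[X in X < _]P0.
by apply => //; rewrite in_itv/= ?andbT// ltW.
Qed.

Lemma le_orlicz x y : 0 <= x -> x <= y -> Phi x <= Phi y.
Proof.
case: Phi_orlicz => _ _ incr _ _ x0; rewrite le_eqVlt => /predU1P[->//|xy].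
by apply/ltW/incr => //; rewrite in_itv/= andbT// (le_trans x0)// ltW.
Qed.

Lemma orlicz_eq0 x : 0 <= x -> Phi x = 0 -> x = 0.
Proof.
by rewrite le_eqVlt => /predU1P[//|/orlicz_gt0 + Px]; rewrite Px ltxx.
Qed.

(** This is right-continuity of [Phi] at [0], where it vanishes. *)
Lemma orlicz_small e : 0 < e -> exists2 t, 0 < t & Phi t <= e.
Proof.
move=> e0; case: Phi_orlicz => P0 _ _ /continuous_within_itvcyP[_ +] _.
rewrite P0 => /cvgrPdist_lt/(_ _ e0) Pe.
near (0:R)^'+ => t.
have t0 : 0 < t by [].
exists t => //; have : `|0 - Phi t| < e by near: t.
by rewrite sub0r normrN => /ltW; apply: le_trans; exact: ler_norm.
Unshelve. all: by end_near. Qed.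

(** [Phi] is continuous, hence Borel, on [[0, +oo[], and the inner function takes its values
    there. *)
Lemma measurable_orlicz_comp d (T : measurableType d) (f : T -> R) e :
  0 < e -> measurable_fun setT f ->
  measurable_fun setT (fun x => (Phi (`|f x| / e))%:E).
Proof.
move=> e0 mf; apply/measurable_EFinP.
have mPhi : measurable_fun (`[0, +oo[%classic : set R) Phi.
  apply: subspace_continuous_measurable_fun; first exact: measurable_itv.
  by case: Phi_orlicz.
apply: (measurable_comp (measurable_itv `[0, +oo[) _ mPhi).
  by move=> _ [x _ <-]/=; rewrite in_itv/= andbT divr_ge0// ltW.
apply: measurable_funM => //; exact: measurableT_comp.
Qed.

Lemma orlicz_comp_ge0 (T : Type) (f : T -> R) e x : 0 < e ->
  (0 <= (Phi (`|f x| / e))%:E)%E.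
Proof. by move=> e0; rewrite lee_fin orlicz_ge0// divr_ge0// ltW. Qed.

(** * Integrals of [Phi (|f| / e)] over balls, and the two signs of the exponent *)

Section modular.
Context {n : nat}.
Implicit Types (f g : 'rV[R]_n -> R) (lambda r e C : R).

Lemma ball_norm_le_modular f lambda r e : 0 < r -> 0 < e ->
  (\int[@lebesgue_rV R n]_(x in central_ball r) (Phi (`|f x| / e))%:E
    <= (fine (lebesgue_rV (central_ball r : set 'rV[R]_n)) `^ lambda)%:E)%E ->
  (Morrey_Orlicz_ball_norm Phi lambda r f <= e%:E)%E.
Proof.
move=> r0 e0 fe; apply: ereal_inf_lbound; exists e => //; split => //.
by rewrite lee_pdivrMl ?mule1// powR_gt0// lebesgue_rV_central_ball_gt0.
Qed.

(** The strict inequality yields an admissible [e < C], whether or not the infimum is attained;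
    replacing [e] by [C] lowers the integrand, as [Phi] is nondecreasing. *)
Lemma modular_le_ball_norm f lambda r C : measurable_fun setT f -> 0 < r ->
  (Morrey_Orlicz_ball_norm Phi lambda r f < C%:E)%E ->
  (\int[@lebesgue_rV R n]_(x in central_ball r) (Phi (`|f x| / C))%:E
    <= (fine (lebesgue_rV (central_ball r : set 'rV[R]_n)) `^ lambda)%:E)%E.
Proof.
move=> mf r0 /ereal_inf_lt[_ [e [e0 +] <-]]; rewrite lte_fin => + eC.
have C0 : 0 < C by exact: lt_trans eC.
rewrite lee_pdivrMl ?mule1 ?powR_gt0 ?lebesgue_rV_central_ball_gt0//.
apply: le_trans; apply: ge0_le_integral => //.
- exact: measurable_central_ball.
- by move=> x _; exact: orlicz_comp_ge0.
- by apply: (measurable_funS measurableT) => //; exact: measurable_orlicz_comp.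
- by apply: (measurable_funS measurableT) => //; exact: measurable_orlicz_comp.
- move=> x _; rewrite lee_fin; apply: le_orlicz.
    by rewrite divr_ge0// ltW.
  by rewrite ler_wpM2l// lef_pV2 ?posrE// ltW.
Qed.

Lemma ae_eq_modular f g r e : measurable_fun setT f -> measurable_fun setT g ->
  f = g %[ae @lebesgue_rV R n] -> 0 < r -> 0 < e ->
  (\int[@lebesgue_rV R n]_(x in central_ball r) (Phi (`|f x| / e))%:E =
   \int[@lebesgue_rV R n]_(x in central_ball r) (Phi (`|g x| / e))%:E)%E.
Proof.
move=> mf mg fg r0 e0; apply: ge0_ae_eq_integral => //.
- exact: measurable_central_ball.
- by apply: (measurable_funS measurableT) => //; exact: measurable_orlicz_comp.
- by apply: (measurable_funS measurableT) => //; exact: measurable_orlicz_comp.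
- by move=> x _; exact: orlicz_comp_ge0.
- by move=> x _; exact: orlicz_comp_ge0.
- by apply: filterS fg => x fgx _; rewrite fgx.
Qed.

Lemma lt0_exponent_ae0 f lambda : (0 < n)%N -> lambda < 0 ->
  measurable_fun setT f ->
  (central_Morrey_Orlicz_norm Phi lambda f < +oo)%E ->
  f = cst 0 %[ae @lebesgue_rV R n].
Proof.
move=> n0 l0 mf foo.
have [C C0 fC] : exists2 C, 0 < C & forall r, 0 < r ->
    (Morrey_Orlicz_ball_norm Phi lambda r f < C%:E)%E.
  pose N := central_Morrey_Orlicz_norm Phi lambda f.
  (* The absolute value makes the constant positive and the added [1] makes the bound strict. The
     case [N = -oo], where [fine N] is [0], is covered too. *)
  exists (`|fine N| + 1); first by rewrite ltr_wpDl.
  move=> r r0; apply: (@le_lt_trans _ _ N).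
    by apply: ereal_sup_ubound; exists r.
  move: foo; rewrite -/N; case: N => [N _|//|_] /=; last exact: ltNyr.
  by rewrite lte_fin (le_lt_trans (ler_norm _))// ltrDl.
have mPhi : measurable_fun setT (fun x => (Phi (`|f x| / C))%:E).
  exact: measurable_orlicz_comp.
have int0 r : 0 < r -> (\int[@lebesgue_rV R n]_(x in central_ball r)
    (Phi (`|f x| / C))%:E = 0)%E.
  move=> r0; apply/eqP; rewrite eq_le; apply/andP; split; last first.
    by apply: integral_ge0 => x _; exact: orlicz_comp_ge0.
  apply/lee_addgt0Pr => e e0; rewrite add0e.
  (* The estimate is applied on a ball of radius [s >= r] so large that its right-hand side is at
     most [e]. *)
  have [s [rs s0] se] := central_ball_pow_lt0_small n r lambda e n0 l0 e0.
  apply: (@le_trans _ _ (\int[@lebesgue_rV R n]_(x in central_ball s)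
    (Phi (`|f x| / C))%:E)%E).
    apply: ge0_subset_integral.
    - exact: measurable_central_ball.
    - exact: measurable_central_ball.
    - exact: (measurable_funS measurableT).
    - by move=> x _; exact: orlicz_comp_ge0.
    - by move=> x; rewrite /central_ball/= => /lt_le_trans; exact.
  apply: (le_trans (modular_le_ball_norm f lambda s C mf s0 (fC s s0))).
  by rewrite lee_fin.
(* Countably many balls with integer radii exhaust the space, so their exceptional null sets can be
   united; [x] lies in the ball of radius one more than the integer part of its norm. *)
have ae0 k : \forall x \ae @lebesgue_rV R n,
    central_ball k.+1%:R x -> (Phi (`|f x| / C))%:E = 0%E.
  have mBk : measurable (central_ball k.+1%:R : set 'rV[R]_n).
    exact: measurable_central_ball.
  have mPhik :=
    measurable_funS measurableT (@subsetT _ (central_ball k.+1%:R)) mPhi.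
  apply: (iffLR (ae_eq_integral_abs (@lebesgue_rV R n) mBk mPhik)).
  rewrite -[RHS](int0 k.+1%:R)//; apply: eq_integral => x _.
  by rewrite gee0_abs//; exact: orlicz_comp_ge0.
apply: filterS (ae_foralln ae0) => x /(_ (Num.trunc (euclidean_norm x))).
move=> /(_ (truncnS_gt _)) [] /orlicz_eq0.
rewrite divr_ge0 ?(ltW C0)// => /(_ erefl) /eqP.
by rewrite mulf_eq0 invr_eq0 (gt_eqF C0) orbF normr_eq0 => /eqP.
Qed.

Lemma modular_indic_cube_le lambda : (0 < n)%N -> 0 <= lambda ->
  exists2 e, 0 < e & forall r, 0 < r ->
  (\int[@lebesgue_rV R n]_(x in central_ball r)
     (Phi (`|\1_(cube_rV n 1 2) x| / e))%:E
    <= (fine (lebesgue_rV (central_ball r : set 'rV[R]_n)) `^ lambda)%:E)%E.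
Proof.
move=> n0 l0.
pose c := fine (lebesgue_rV (central_ball 1 : set 'rV[R]_n)) `^ lambda.
have c0 : 0 < c by rewrite powR_gt0// lebesgue_rV_central_ball_gt0.
have [t t0 tc] := orlicz_small c c0.
(* With this choice the integrand is [Phi t <= c] on the cube, and [Phi 0 = 0] off it. *)
exists t^-1 => [|r r0]; first by rewrite invr_gt0.
have PhiE (x : 'rV[R]_n) : (Phi (`|\1_(cube_rV n 1 2) x| / t^-1))%:E =
    ((Phi t)%:E * (\1_(cube_rV n 1 2) x)%:E)%E.
  rewrite invrK indicE; case: (_ \in _).
    by rewrite normr1 mul1r mule1.
  by rewrite normr0 mul0r orlicz0 mule0.
have mB := measurable_central_ball n r r0.
have mC := @measurable_cube_rV R n 1 2.
under eq_integral do rewrite PhiE.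
rewrite ge0_integralZl//; last 2 first.
- by apply/measurable_EFinP; exact: measurable_indic.
- by rewrite lee_fin orlicz_ge0// ltW.
rewrite integral_indic//; have [r1|r1] := leP r 1.
  rewrite (_ : _ `&` _ = set0) ?measure0 ?mule0 ?lee_fin ?powR_ge0//.
  (* A point of the cube has first coordinate at least [1], hence norm at least [1]. *)
  apply/seteqP; split => // x [/(_ (Ordinal n0)) + xr].
  rewrite in_itv/= => /andP[x1 _]; have := lt_le_trans xr r1.
  rewrite ltNge (le_trans x1)// (le_trans (ler_norm _))//.
  by rewrite coord_le_euclidean_norm.
(* The cube has volume [1], so the integral is at most [Phi t <= c]; for [r > 1], [c] is at most the
   required bound since [lambda >= 0]. *)
apply: (@le_trans _ _ (Phi t)%:E).
  rewrite -[leRHS]mule1 lee_wpmul2l ?lee_fin ?orlicz_ge0 ?(ltW t0)//.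
  apply: (@le_trans _ _ (lebesgue_rV (cube_rV n 1 2))).
    by apply: le_measure; rewrite ?inE//; exact: measurableI.
  by rewrite lebesgue_rV_cube ?ltr1n// (addrK 1 1 : 2 - 1 = 1 :> R) expr1n.
rewrite lee_fin (le_trans tc)// ge0_ler_powR// ?nnegrE ?fine_ge0//.
by rewrite le_lebesgue_rV_central_ball// ltW.
Qed.

End modular.
End orlicz.

(** * Classes modulo equality almost everywhere and their representatives *)

Lemma ae_eq_repr_pi d1 d2 (R : realType) (T1 : measurableType d1)
    (T2 : measurableType d2) (mu : {measure set T1 -> \bar R})
    (g : {mfun T1 >-> T2}) :
  aqEqMfun_to_fun (\pi_({mfun_ mu, T1 >-> T2}) g)%qT = g %[ae mu].
Proof.
have /eqmodP/asboolP// : (repr (\pi_({mfun_ mu, T1 >-> T2}) g) = g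
  %[mod {mfun_ mu, T1 >-> T2}])%qT.
exact: reprK.
Qed.

Lemma pi_eq_ae d1 d2 (R : realType) (T1 : measurableType d1)
    (T2 : measurableType d2) (mu : {measure set T1 -> \bar R})
    (f : {mfun_ mu, T1 >-> T2}) (g : {mfun T1 >-> T2}) :
  (f : T1 -> T2) = g %[ae mu] -> f = (\pi_({mfun_ mu, T1 >-> T2}) g)%qT.
Proof.
move=> fg; rewrite -[LHS]reprK; apply/eqmodP/asboolP; exact: fg.
Qed.

Lemma measurable_ae_function d1 d2 (R : realType) (T1 : measurableType d1)
    (T2 : measurableType d2) (mu : {measure set T1 -> \bar R})
    (f : {mfun_ mu, T1 >-> T2}) : measurable_fun setT (f : T1 -> T2).
Proof. exact: (@measurable_funPT _ _ _ _ (repr f)). Qed.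

Theorem proposition1 (R : realType) (n : nat) (n_ge1 : (1 <= n)%N)
    (Phi : R -> R) (Phi_orlicz : orlicz_function Phi) (lambda : R) :
  central_Morrey_Orlicz n Phi lambda <> [set ae_zero n] <-> 0 <= lambda.
Proof.
split.
  apply: contra_notT; rewrite -ltNge => lambda0.
  apply/seteqP; split=> [f [[mf _] foo]|_ -> /=].
    apply: pi_eq_ae.
    exact: (lt0_exponent_ae0 Phi Phi_orlicz _ lambda n_ge1 lambda0 mf foo).
  (* The chosen representative of the zero class is only known to vanish almost everywhere, so its
     membership is checked through integrals. *)
  have z0 : (ae_zero n : 'rV[R]_n -> R) = cst 0 %[ae @lebesgue_rV R n].
    exact: ae_eq_repr_pi.
  have mz : measurable_fun setT (ae_zero n : 'rV[R]_n -> R).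
    exact: measurable_ae_function.
  split.
    split=> // K _; apply: le_lt_trans.
      by apply: ge0_le_integral_setT => x; rewrite lee_fin.
    rewrite (ge0_ae_eq_integral _ _ _ (g := cst 0%E))//.
    - by rewrite integral0 ltry.
    - by apply/measurable_EFinP; exact: measurableT_comp.
    - by apply: filterS z0 => x /(_ I) -> _; rewrite normr0.
  (* Any positive constant would do as a bound, the integrals being zero. *)
  apply: (@le_lt_trans _ _ 1%:E); last exact: ltry.
  apply/ereal_supP => _ [r /= r0 <-].
  apply: (ball_norm_le_modular Phi) => //.
  rewrite (ae_eq_modular Phi Phi_orlicz _ (cst 0))//.
  rewrite integral0_eq ?lee_fin ?powR_ge0// => x _.
  by rewrite normr0 mul0r orlicz0.
move=> lambda0 M0.
have mC := @measurable_cube_rV R n 1 2.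
pose C : {mfun 'rV[R]_n >-> R} := mindic R mC.
pose f : {mfun_ (@lebesgue_rV R n), 'rV[R]_n >-> R} :=
  (\pi_({mfun_ (@lebesgue_rV R n), 'rV[R]_n >-> R}) C)%qT.
have fC : (f : 'rV[R]_n -> R) = \1_(cube_rV n 1 2) %[ae @lebesgue_rV R n].
  exact: ae_eq_repr_pi.
have mf : measurable_fun setT (f : 'rV[R]_n -> R).
  exact: measurable_ae_function.
have mI : measurable_fun setT (\1_(cube_rV n 1 2) : 'rV[R]_n -> R).
  exact: measurable_indic.
have cube1 : lebesgue_rV (cube_rV n 1 2 : set 'rV[R]_n) = 1%E.
  by rewrite lebesgue_rV_cube ?ltr1n// (addrK 1 1 : 2 - 1 = 1 :> R) expr1n.
have intI : (\int[@lebesgue_rV R n]_x (\1_(cube_rV n 1 2) x)%:E = 1)%E.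
  by rewrite integral_indic// setIT.
have : central_Morrey_Orlicz n Phi lambda f.
  split.
    split=> // K _; apply: le_lt_trans.
      by apply: ge0_le_integral_setT => x; rewrite lee_fin.
    rewrite (ge0_ae_eq_integral _ _ _
      (g := fun x => (\1_(cube_rV n 1 2 : set 'rV[R]_n) x)%:E))//.
    - by rewrite intI ltry.
    - by apply/measurable_EFinP; exact: measurableT_comp.
    - by apply/measurable_EFinP.
    - by apply: filterS fC => x /(_ I) -> _; rewrite ger0_norm.
  have [e e0 Ie] := modular_indic_cube_le Phi Phi_orlicz lambda n_ge1 lambda0.
  apply: (@le_lt_trans _ _ e%:E); last exact: ltry.
  apply/ereal_supP => _ [r /= r0 <-].
  apply: (ball_norm_le_modular Phi) => //.
  rewrite (ae_eq_modular Phi Phi_orlicz _ (\1_(cube_rV n 1 2)))//.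
  exact: Ie.
(* If the space were [{0}], the indicator would vanish almost everywhere, contradicting its integral
   [1]. *)
rewrite M0 => /= f0.
have I0 : (\1_(cube_rV n 1 2) : 'rV[R]_n -> R) = cst 0 %[ae @lebesgue_rV R n].
  have z0 : (ae_zero n : 'rV[R]_n -> R) = cst 0 %[ae @lebesgue_rV R n].
    exact: ae_eq_repr_pi.
  move: fC; rewrite f0 => fC; exact: ae_eq_trans (ae_eq_sym fC) z0.
move: intI; rewrite (ge0_ae_eq_integral _ _ _ (g := cst 0%E))//.
- by rewrite integral0 => /esym/eqP; rewrite onee_eq0.
- by apply/measurable_EFinP.
- by apply: filterS I0 => x /(_ I) -> _.
Qed.
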